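(* Let $B=[\underline c,\overline c]\times[\underline s,\overline s]\subset\mathbb{R}^2$ with $0<\underline c<\overline c$ and $\underline s<\overline s$, and let $$z^1=(\underline c,\overline s,\arctan(\overline s/\underline c)),\quad z^2=(\overline c,\overline s,\arctan(\overline s/\overline c)),\quad z^3=(\overline c,\underline s,\arctan(\underline s/\overline c)),\quad z^4=(\underline c,\underline s,\arctan(\underline s/\underline c))$$ be points of $\mathbb{R}^3$ with coordinates $(c,s,\theta)$. Let $\theta=\gamma_1+\alpha_1c+\beta_1s$ and $\theta=\gamma_2+\alpha_2c+\beta_2s$ be the planes passing through $\{z^1,z^2,z^3\}$ and $\{z^1,z^3,z^4\}$, respectively. For $k=1,2$ define $$\Delta\gamma_k=\max_{(c,s)\in B}\left\{\arctan\left(\frac sc\right)-(\gamma_k+\alpha_kc+\beta_ks)\right\},\qquad \gamma_k'=\gamma_k+\Delta\gamma_k .$$ Then for $k=1,2$, every $x\in\{0,1\}$ and all $(c,s)\in B$, $$\gamma_k'+\alpha_kc+\beta_ks+(2\pi-\gamma_k')(1-x)\ \ge\ \arctan\left(\frac sc\right).$$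
   Context: Here $x$ is the binary variable indicating whether a transmission line is switched on ($x=1$) or off ($x=0$). The variables $c,s$ are real, with the box $B$ giving their bounds when the line is on. The lower bound $\underline c$ is assumed to be positive. *)

(* Defs.v *)
From mathcomp Require Import all_boot all_order all_algebra.
From mathcomp Require Import all_classical all_reals all_analysis.

Set Implicit Arguments.
Unset Strict Implicit.
Unset Printing Implicit Defensive.

Import Order.TTheory GRing.Theory Num.Theory.
Import numFieldNormedType.Exports.

Local Open Scope classical_set_scope.
Local Open Scope ring_scope.

Definition box {R : realType} (cl cu sl su : R) : set (R * R) :=
  `[cl, cu]%classic `*` `[sl, su]%classic.

(* Points of R^3 are nested pairs (c, s, theta). *)
Definition z1 {R : realType} (cl cu sl su : R) : R * R * R :=
  (cl, su, atan (su / cl)).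
Definition z2 {R : realType} (cl cu sl su : R) : R * R * R :=
  (cu, su, atan (su / cu)).
Definition z3 {R : realType} (cl cu sl su : R) : R * R * R :=
  (cu, sl, atan (sl / cu)).
Definition z4 {R : realType} (cl cu sl su : R) : R * R * R :=
  (cl, sl, atan (sl / cl)).

Definition plane {R : realType} (gamma alpha beta : R) : set (R * R * R) :=
  [set z | z.2 = gamma + alpha * z.1.1 + beta * z.1.2].

Definition atan_gap {R : realType} (gamma alpha beta : R) (p : R * R) : R :=
  atan (p.2 / p.1) - (gamma + alpha * p.1 + beta * p.2).

(* For 0 < cl this supremum over the box is attained: see Delta_gamma_max. *)
Definition Delta_gamma {R : realType} (cl cu sl su gamma alpha beta : R) : R :=
  sup (atan_gap gamma alpha beta @` box cl cu sl su).

Definition gamma' {R : realType} (cl cu sl su gamma alpha beta : R) : R :=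
  gamma + Delta_gamma cl cu sl su gamma alpha beta.

Lemma Delta_gamma_max (R : realType) (cl cu sl su gamma alpha beta : R) :
  0 < cl -> cl < cu -> sl < su ->
  (exists2 p, box cl cu sl su p &
     Delta_gamma cl cu sl su gamma alpha beta = atan_gap gamma alpha beta p) /\
  (forall p, box cl cu sl su p ->
     atan_gap gamma alpha beta p <= Delta_gamma cl cu sl su gamma alpha beta).
Proof.
move=> cl0 clu slu.
have B0 : box cl cu sl su !=set0.
  by exists (cl, sl); split; rewrite /= in_itv /= lexx ltW.
have cB : compact (box cl cu sl su).
  by apply: compact_setX; exact: segment_compact.
have cf : {within box cl cu sl su, continuous (atan_gap gamma alpha beta)}.
  apply: continuous_in_subspaceT => p /set_mem [/=].
  rewrite in_itv /= => /andP[clp _] _.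
  have p0 : p.1 != 0 by rewrite gt_eqF// (lt_le_trans cl0).
  have c1 : (fun q : R * R => q.1) @ p --> p.1 by exact: cvg_fst.
  have c2 : (fun q : R * R => q.2) @ p --> p.2 by exact: cvg_snd.
  apply: cvgB.
    apply: (@continuous_comp _ _ _ (fun q : R * R => q.2 / q.1) atan).
      by apply: cvgM => //; exact: cvgV.
    exact: continuous_atan.
  apply: cvgD; last by apply: cvgM => //; exact: cvg_cst.
  by apply: cvgD; [exact: cvg_cst | apply: cvgM => //; exact: cvg_cst].
have [p /set_mem Bp pmax] := compact_EVT_max B0 cB cf.
have ub : ubound (atan_gap gamma alpha beta @` box cl cu sl su)
    (atan_gap gamma alpha beta p).
  by move=> _ [q Bq <-]; apply: pmax; exact: mem_set.
have hub : has_ubound (atan_gap gamma alpha beta @` box cl cu sl su).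
  by exists (atan_gap gamma alpha beta p).
split; last by move=> q Bq; apply: ub_le_sup => //; exists q.
exists p => //; apply/eqP; rewrite eq_le; apply/andP; split.
  by apply: ge_sup => //; exists (atan_gap gamma alpha beta p), p.
by apply: ub_le_sup => //; exists p.
Qed.

(* Main.v *)
Require Import Defs.
From mathcomp Require Import all_boot all_order all_algebra.
From mathcomp Require Import all_classical all_reals all_analysis.
From mathcomp Require Import lra.

(** For [x = 1] the claim says that [gamma'] lifts the plane above the surface
[theta = atan (s / c)], which is what the maximum in [Delta_gamma] is for
([Delta_gamma_max]).

For [x = 0] the lifted constant cancels and what remains is
[2 * pi + alpha * c + beta * s >= atan (s / c)].  It follows from three separate
estimates: [atan (s / c) < pi / 2], [alpha * c >= - (pi / 2)] and
[beta * s >= - pi].  The last two hold because two vertices on a common side of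
the box force [alpha] (resp. [beta]) to be the slope of a chord of the surface
along that side, [s] (resp. [c]) being constant there.  A slope can be large
when [cl] is small, so what must be bounded is the slope times the variable.
The reason is the same in both cases: [atan] is concave on the nonnegative
reals and vanishes at 0, so its chord over [[a, b]] is flatter than its chord
over [[0, b]], whence [b] times the slope is at most [atan b]
([atan_chord_le]).  Along [s] constant this applies after rewriting
[atan (s / c)] as [pi / 2 - atan (c / s)] ([atanV]).  Along [c] constant it
applies up to a reflection when [s] keeps one sign; when [s] changes sign, the
side is longer than every [- s] to be bounded and [atan] rises by less than
[pi] along it. *)

Import Order.TTheory GRing.Theory Num.Theory.
Import numFieldNormedType.Exports.

Local Open Scope classical_set_scope.
Local Open Scope ring_scope.

Lemma atan_gt0 {R : realType} {x : R} : 0 < x -> 0 < atan x.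
Proof. by move=> x0; rewrite -(atan0 R); apply: lt_atan. Qed.

Lemma atanV {R : realType} {x : R} : 0 < x -> atan x^-1 = pi / 2 - atan x.
Proof.
move=> x0; have y0 := atan_gt0 x0; have y1 := atan_ltpi2 x.
rewrite -[RHS]tanK; last by rewrite in_itv /=; apply/andP; split; lra.
by rewrite -[in LHS](atanK x) /tan sinB cosB sin_pihalf cos_pihalf
  !mul0r !mul1r subr0 add0r invf_div.
Qed.

(** The chord slope of [atan] over [[a, b]] is a value of the decreasing
derivative [1 / (1 + x ^+ 2)] beyond [a], the one over [[0, a]] a value before
[a]; comparing both with the derivative at [a] gives [a * atan b <= b * atan a],
which is the claim rearranged. *)
Lemma atan_chord_le {R : realType} {a b : R} : 0 <= a -> a <= b ->
  b * (atan b - atan a) <= (b - a) * atan b.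
Proof.
move=> a0 ab.
have mvt (x y : R) : x <= y ->
    exists2 t, t \in `[x, y] & atan y - atan x = (1 + t ^+ 2)^-1 * (y - x).
  move=> xy; apply: (MVT_segment xy (fun t _ => is_derive1_atan t)).
  by apply: continuous_subspaceT => t; exact: continuous_atan.
have decr (t u : R) : 0 <= t -> t <= u -> (1 + u ^+ 2)^-1 <= (1 + t ^+ 2)^-1.
  by move=> t0 tu; rewrite lef_pV2 ?posrE; nra.
have [t + Et] := mvt _ _ ab; rewrite in_itv /= => /andP[a_t _].
have [u + Eu] := mvt _ _ a0; rewrite in_itv /= => /andP[u0 ua].
rewrite atan0 !subr0 in Eu.
have slopes := le_trans (decr _ _ a0 a_t) (decr _ _ u0 ua).
suff : a * (atan b - atan a) <= (b - a) * atan a by lra.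
rewrite Et Eu [leLHS]mulrCA [leRHS]mulrCA [a * _]mulrC.
by rewrite ler_wpM2r // mulr_ge0 // subr_ge0.
Qed.

Lemma atan_chord_scaled_le {R : realType} {a b d : R} :
    0 < d -> 0 <= a -> a <= b ->
  b * (atan (b / d) - atan (a / d)) <= (b - a) * atan (b / d).
Proof.
move=> d0 a0 ab; rewrite -(ler_pM2r (x := d^-1)) ?invr_gt0 //.
rewrite ![_ * _ / d]mulrAC mulrBl atan_chord_le //.
  exact: divr_ge0 a0 (ltW d0).
by rewrite ler_pM2r ?invr_gt0.
Qed.

(** The slope is nonnegative, so for [s < 0] the worst case is [s = sl].  If
[0 <= su], the chord is at least as long as [- sl] and its total rise is less
than [pi]; otherwise reflection through the origin brings the chord to the
nonnegative reals. *)
Lemma slope_s_mul_ge {R : realType} {c0 sl su beta s : R} :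
  0 < c0 -> sl < su -> beta * (su - sl) = atan (su / c0) - atan (sl / c0) ->
  sl <= s -> - pi <= beta * s.
Proof.
move=> c0_gt0 ltsl Ebeta sls.
have pi_gt0 := pi_gt0 R.
have rise : atan (sl / c0) <= atan (su / c0).
  by apply: le_atan; rewrite ler_pM2r ?invr_gt0 ?ltW.
have beta0 : 0 <= beta by nra.
have [s0|s0] := leP 0 s; first by nra.
suff : - pi <= beta * sl by nra.
have sl0 : sl < 0 by lra.
have bnd1 := atan_ltpi2 (su / c0); have bnd2 := atan_gtNpi2 (sl / c0).
have [su0|su0] := leP 0 su; first by nra.
have : - sl * (atan (- sl / c0) - atan (- su / c0))
    <= (- sl - - su) * atan (- sl / c0).
  by apply: atan_chord_scaled_le => //; lra.
rewrite !mulNr !atanN; nra.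
Qed.

(** Only for [s > 0] is the slope negative, and then the worst case is [c = cu];
in terms of [c / s] the chord lies on the nonnegative reals. *)
Lemma slope_c_mul_ge {R : realType} {s cl cu alpha c : R} :
  0 < cl -> cl < cu -> alpha * (cu - cl) = atan (s / cu) - atan (s / cl) ->
  0 <= c -> c <= cu -> - (pi / 2) <= alpha * c.
Proof.
move=> cl0 clu Ealpha c0 ccu.
have pi_gt0 := pi_gt0 R.
have cu0 : 0 < cu by lra.
have Vcul : cu^-1 <= cl^-1 by rewrite lef_pV2 ?posrE // ltW.
have [s0|s0] := leP s 0.
  have rise : atan (s / cl) <= atan (s / cu) by apply: le_atan; nra.
  have alpha0 : 0 <= alpha by nra.
  nra.
have fall : atan (s / cu) <= atan (s / cl) by apply: le_atan; nra.
have alpha0 : alpha <= 0 by nra.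
suff : - (pi / 2) <= alpha * cu by nra.
have Einv d : 0 < d -> atan (s / d) = pi / 2 - atan (d / s).
  by move=> d0; rewrite -atanV ?divr_gt0 // invf_div.
have := atan_chord_scaled_le s0 (ltW cl0) (ltW clu).
have bnd := atan_ltpi2 (cu / s).
rewrite !Einv // in Ealpha *.
nra.
Qed.

(** The sides [s = s0] and [c = c0] that determine the two slopes are left
arbitrary because the two planes use opposite sides of the box. *)
Lemma lifted_plane_ge {R : realType} {cl cu sl su gamma alpha beta c0 s0 : R} :
  0 < cl -> cl < cu -> sl < su -> 0 < c0 ->
  alpha * (cu - cl) = atan (s0 / cu) - atan (s0 / cl) ->
  beta * (su - sl) = atan (su / c0) - atan (sl / c0) ->
  forall x c s : R, x = 0 \/ x = 1 -> box cl cu sl su (c, s) ->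
    let g := gamma' cl cu sl su gamma alpha beta in
    atan (s / c) <= g + alpha * c + beta * s + (2 * pi - g) * (1 - x).
Proof.
move=> cl_gt0 lt_cl_cu lt_sl_su c0_gt0 Ealpha Ebeta x c s x01 Bcs /=.
have [] := Bcs; rewrite /= !in_itv /= => /andP[clc ccu] /andP[sls _].
case: x01 => ->.
  have := slope_c_mul_ge cl_gt0 lt_cl_cu Ealpha (le_trans (ltW cl_gt0) clc) ccu.
  have := slope_s_mul_ge c0_gt0 lt_sl_su Ebeta sls.
  have := atan_ltpi2 (s / c).
  lra.
have [_ /(_ _ Bcs)] :=
  Delta_gamma_max gamma alpha beta cl_gt0 lt_cl_cu lt_sl_su.
rewrite /atan_gap /gamma' /=; lra.
Qed.

Theorem proposition4p1 (R : realType) (cl cu sl su : R)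
    (cl_gt0 : 0 < cl) (lt_cl_cu : cl < cu) (lt_sl_su : sl < su)
    (gamma1 alpha1 beta1 gamma2 alpha2 beta2 : R)
    (plane1 : [set z1 cl cu sl su; z2 cl cu sl su; z3 cl cu sl su]
                `<=` plane gamma1 alpha1 beta1)
    (plane2 : [set z1 cl cu sl su; z3 cl cu sl su; z4 cl cu sl su]
                `<=` plane gamma2 alpha2 beta2) :
  forall x c s : R, x = 0 \/ x = 1 -> box cl cu sl su (c, s) ->
    let gamma1' := gamma' cl cu sl su gamma1 alpha1 beta1 in
    let gamma2' := gamma' cl cu sl su gamma2 alpha2 beta2 in
    gamma1' + alpha1 * c + beta1 * s + (2 * pi - gamma1') * (1 - x)
      >= atan (s / c) /\
    gamma2' + alpha2 * c + beta2 * s + (2 * pi - gamma2') * (1 - x)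
      >= atan (s / c).
Proof.
have cu_gt0 : 0 < cu := lt_trans cl_gt0 lt_cl_cu.
have z11 := plane1 _ (or_introl (or_introl erefl)).
have z12 := plane1 _ (or_introl (or_intror erefl)).
have z13 := plane1 _ (or_intror erefl).
have z21 := plane2 _ (or_introl (or_introl erefl)).
have z23 := plane2 _ (or_introl (or_intror erefl)).
have z24 := plane2 _ (or_intror erefl).
rewrite /plane /z1 /z2 /z3 /z4 /= in z11 z12 z13 z21 z23 z24.
move=> x c s x01 Bcs /=; split.
(* [z1] and [z2] lie on the side [s = su], [z2] and [z3] on [c = cu]. *)
- by apply: (lifted_plane_ge (c0 := cu) (s0 := su)) => //; lra.
(* [z3] and [z4] lie on the side [s = sl], [z1] and [z4] on [c = cl]. *)
- by apply: (lifted_plane_ge (c0 := cl) (s0 := sl)) => //; lra.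
Qed.
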